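(* Let $n\ge 1$ be an integer and let $X$ be a combinatorially $n$-essential simplicial complex with edge-path systole $\operatorname{sys} X$. Then the number of vertices of $X$ is at least \[ \binom{n + \left\lfloor\frac{\operatorname{sys} X}{2}\right\rfloor - 1}{n-1} + 2 \binom{n + \left\lfloor\frac{\operatorname{sys} X}{2}\right\rfloor - 1}{n} - 1 , \] and moreover \[ \binom{n + \left\lfloor\frac{\operatorname{sys} X}{2}\right\rfloor - 1}{n-1} + 2 \binom{n + \left\lfloor\frac{\operatorname{sys} X}{2}\right\rfloor - 1}{n} - 1 \ \ge\ \binom{n + \left\lfloor\frac{\operatorname{sys} X}{2} \right\rfloor}{n} \ \ge\ \frac{1}{n!} \left\lceil\frac{\operatorname{sys} X}{2} \right\rceil^n. \]
   Context: For a simplicial complex $X$, $V(X)$ denotes its vertex set. For $W\subset V(X)$, $\langle W\rangle$ denotes the induced subcomplex, consisting of all faces of $X$ whose vertices all lie in $W$. The (edge-path) systole $\operatorname{sys} X$ is the smallest integer such that every closed path along the edges of $X$ of edge-length less than $\operatorname{sys} X$ is null-homotopic in $X$; if every component of $X$ is simply connected, $\operatorname{sys} X=+\infty$ by convention. A subset $Y\subset V(X)$ is called inessential if for every connected component $C$ of $\langle Y\rangle$, with $D$ the connected component of $X$ containing $C$, the natural map $\pi_1(C)\to\pi_1(D)$ is trivial. The complex $X$ is called combinatorially $n$-essential if $V(X)$ cannot be partitioned into $n$ or fewer inessential sets. (For $n\ge1$ a combinatorially $n$-essential complex has non-contractible loops, so its systole is finite.) *)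

(* Defs.v *)
From HB Require Import structures.
From mathcomp Require Import all_boot all_order all_algebra.
From mathcomp Require Import finmap.
From mathcomp Require Import boolp classical_sets functions cardinality.
From mathcomp Require Import constructive_ereal.

Set Implicit Arguments.
Unset Strict Implicit.
Unset Printing Implicit Defensive.

Local Open Scope fset_scope.
Local Open Scope classical_set_scope.

(* Abstract simplicial complexes, possibly infinite; an element v of T is a
   vertex only when [fset v] is a face. *)
Record complex (T : choiceType) := Complex {
  faces : set {fset T};
  face_neq0 : forall F : {fset T}, faces F -> F != fset0;
  face_sub : forall F G : {fset T},
    faces F -> (G `<=` F)%fset -> G != fset0 -> faces G }.

Section Complexes.
Variable T : choiceType.
Implicit Types (X C D : complex T) (W Y : set T) (u v w x y z : T).
Implicit Types (p q r s t : seq T).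

Definition vertices X : set T := [set v | faces X [fset v]].

Definition induced_faces X W : set {fset T} :=
  [set F | faces X F /\ forall v, v \in F -> W v].

Lemma induced_face_neq0 X W (F : {fset T}) : induced_faces X W F -> F != fset0.
Proof. by case=> /face_neq0. Qed.

Lemma induced_face_sub X W (F G : {fset T}) :
  induced_faces X W F -> (G `<=` F)%fset -> G != fset0 -> induced_faces X W G.
Proof.
move=> [XF WF] GF G0; split; first exact: face_sub XF GF G0.
by move=> v vG; apply: WF; apply: (fsubsetP GF).
Qed.

Definition induced X W : complex T :=
  Complex (@induced_face_neq0 X W) (@induced_face_sub X W).

Definition edge X : rel T := fun x y => (x != y) && ([fset x; y] \in faces X).

(* An edge path is given by its initial vertex x and the sequence p of its
   other vertices; its edge-length is size p. *)
Definition edge_path X x p : Prop := vertices X x /\ path (edge X) x p.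

Definition closed_edge_path X x p : Prop := edge_path X x p /\ last x p = x.

(* The elementary moves of the edge-path group, on full vertex sequences.
   Every move, in either direction, turns an edge path into an edge path with
   the same endpoints, so on edge paths this is homotopy relative to the
   endpoints within edge paths. *)
Inductive edge_homotopic X : seq T -> seq T -> Prop :=
| EH_refl p : edge_homotopic X p p
| EH_sym p q : edge_homotopic X p q -> edge_homotopic X q p
| EH_trans p q r :
    edge_homotopic X p q -> edge_homotopic X q r -> edge_homotopic X p r
| EH_backtrack s t x y : edge X x y ->
    edge_homotopic X (s ++ [:: x; y; x] ++ t) (s ++ [:: x] ++ t)
| EH_triangle s t x y z : uniq [:: x; y; z] -> faces X [fset x; y; z] ->
    edge_homotopic X (s ++ [:: x; y; z] ++ t) (s ++ [:: x; z] ++ t).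

Definition null_homotopic X x p : Prop := edge_homotopic X (x :: p) [:: x].

(* For a subcomplex C of D: the map pi_1(C, x) -> pi_1(D, x) of edge-path
   groups induced by the inclusion is trivial for every base point x in C. *)
Definition pi1_trivial C D : Prop :=
  forall x p, closed_edge_path C x p -> null_homotopic D x p.

(* The connected component of the vertex v. *)
Definition component X v : complex T :=
  induced X [set w | exists2 p, edge_path X v p & last v p = w].

(* C ranges over the components of <Y>, each given by one of its vertices v. *)
Definition inessential X Y : Prop :=
  Y `<=` vertices X /\
  forall v, vertices (induced X Y) v ->
    pi1_trivial (component (induced X Y) v) (component X v).

Definition combinatorially_essential (n : nat) X : Prop :=
  ~ exists (m : nat) (P : nat -> set T),
      [/\ (m <= n)%N, partition `I_m P (vertices X) &
          forall i, `I_m i -> inessential X (P i)].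

Definition short_loops_trivial X (k : nat) : Prop :=
  forall x p, closed_edge_path X x p -> (size p < k)%N -> null_homotopic X x p.

(* The largest k such that all closed edge paths of length < k are
   null-homotopic, i.e. the least length of one that is not null-homotopic;
   no such k exists exactly when all closed edge paths are null-homotopic. *)
Definition systole X : \bar nat :=
  xget +oo%E [set k%:E%E | k in
    [set k | short_loops_trivial X k /\
             forall j, short_loops_trivial X j -> (j <= k)%N]].

End Complexes.

(* Main.v *)
Require Import Defs.
From mathcomp Require Import all_boot all_order all_algebra.
From mathcomp Require Import finmap zify.
From mathcomp Require Import boolp classical_sets functions cardinality.
From mathcomp Require Import constructive_ereal.

(** Let s be the systole of X and m = floor (s / 2), so that all closed edge
    paths of length less than 2m are null-homotopic; the systole is finite
    because an essential complex has a loop that is not null-homotopic. A set A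
    of vertices is handled through the condition that every loop inside A is
    null-homotopic in X, written [pi1_trivial (induced X A) X], which implies
    inessentiality ([inessential_of_pi1_trivial]). The argument combines the
    growth of balls with the choice of a minimal cutting set.

    A ball of radius r < m, in the path metric of a set W of vertices, is
    inessential: a loop in it is a product of loops of length at most 2r + 1
    through the centre ([ball_pi1_trivial]). If W is n-essential, choose Z in W
    of least cardinality such that W minus Z is inessential; then Z is
    (n-1)-essential. Let B, B' be the W-balls of radii r and r + 1 around a
    point of Z, with r < m. Replacing the part of Z inside B' by the sphere
    B' minus B gives another cutting set, because the sphere separates B from
    the rest of W. Minimality yields |Z meet B'| <= |B' minus B|
    ([cut_sphere]). So the spheres of W are at least as large as the balls of
    the (n-1)-essential set Z, which are bounded below by induction, and summing
    spheres bounds the balls of W. The complement of an inessential ball is a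
    cutting set as well, so the part of W outside the ball of radius m - 1 has
    at least |Z| points.

    The induction starts at n = 1 with a shortest loop in W that is not
    null-homotopic: it has length at least 2m and is isometrically embedded in
    W, so for 0 < r < m the sphere of radius r around a point of the loop
    contains at least two points of it ([essential1_spheres]). The resulting
    recursion f_n(r+1) = f_n(r) + f_(n-1)(r+1), with f_n(0) = 1 and
    f_1(r) = 2r + 1, is solved by sums of binomial coefficients
    ([ball_bound]). *)

Set Implicit Arguments.
Unset Strict Implicit.
Unset Printing Implicit Defensive.

Local Open Scope classical_set_scope.

(** * Induced subcomplexes and loops that die in the ambient complex *)

Section Complex.
Variables (T : choiceType) (X : complex T).
Implicit Types (A B : set T) (x y z : T) (p q d s t : seq T).

Lemma edge_sym : symmetric (edge X).
Proof. by move=> x y; rewrite /edge eq_sym fsetUC. Qed.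

Lemma edge_vertices x y : edge X x y -> vertices X x /\ vertices X y.
Proof.
case/andP=> _ /set_mem XF; split; apply: (face_sub XF);
  by [rewrite fsub1set !inE eqxx ?orbT | rewrite -cardfs_eq0 cardfs1].
Qed.

Lemma edge_induced A x y :
  edge (induced X A) x y = [&& edge X x y, x \in A & y \in A].
Proof.
rewrite /edge -andbA; congr (_ && _); apply/idP/idP.
  move=> /set_mem [XF FA]; rewrite (mem_set XF).
  by rewrite !mem_set //; apply: FA; rewrite in_fset2 eqxx ?orbT.
case/andP=> /set_mem XF /andP [/set_mem Ax /set_mem Ay]; apply/mem_set.
by split=> // v; rewrite !inE => /orP [] /eqP->.
Qed.

Lemma sub_path_induced A B x p :
  A `<=` B -> path (edge (induced X A)) x p -> path (edge (induced X B)) x p.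
Proof.
move=> AB; apply: sub_path => y z; rewrite !edge_induced.
by case/and3P=> -> /set_mem/AB/mem_set-> /set_mem/AB/mem_set->.
Qed.

Lemma path_induced A x p : path (edge (induced X A)) x p -> path (edge X) x p.
Proof. by apply: sub_path => y z; rewrite edge_induced => /and3P []. Qed.

Lemma induced_vertex A x : vertices (induced X A) x <-> vertices X x /\ A x.
Proof.
split=> [[Xx Ax]|[Xx Ax]]; first by split=> //; apply: Ax; rewrite inE.
by split=> // v; rewrite inE => /eqP->.
Qed.

Lemma closed_edge_path_induced A x p :
  closed_edge_path (induced X A) x p -> closed_edge_path X x p.
Proof.
by case=> [[/induced_vertex [Xx _] /path_induced Hp] Hl].
Qed.

Lemma closed_edge_path_sub A B x p : A `<=` B ->
  closed_edge_path (induced X A) x p -> closed_edge_path (induced X B) x p.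
Proof.
move=> AB [[/induced_vertex [Xx Ax] Hp] Hl]; split=> //; split.
  by apply/induced_vertex; split=> //; apply: AB.
exact: sub_path_induced Hp.
Qed.

Lemma pi1_trivial_sub A B : A `<=` B ->
  pi1_trivial (induced X B) X -> pi1_trivial (induced X A) X.
Proof. by move=> AB HB x p /(closed_edge_path_sub AB) /HB. Qed.

(** * Calculus of edge homotopies *)

Lemma homotopic_cat s t p q :
  edge_homotopic X p q -> edge_homotopic X (s ++ p ++ t) (s ++ q ++ t).
Proof.
elim=> {p q} [p|p q _ IH|p q r _ IH1 _ IH2|s' t' x y e|s' t' x y z u f].
- exact: EH_refl.
- exact: EH_sym.
- exact: EH_trans IH1 IH2.
- by rewrite -!catA !(catA s); apply: EH_backtrack.
- by rewrite -!catA !(catA s); apply: EH_triangle.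
Qed.

Lemma homotopic_catl s p q :
  edge_homotopic X p q -> edge_homotopic X (s ++ p) (s ++ q).
Proof. by move=> /(homotopic_cat s [::]); rewrite !cats0. Qed.

Lemma homotopic_catr t p q :
  edge_homotopic X p q -> edge_homotopic X (p ++ t) (q ++ t).
Proof. by move=> /(homotopic_cat [::] t). Qed.

(** The traversed path comes first reversed and then forwards, so that
    consecutive concatenations share their endpoint only once. *)
Lemma homotopic_retrace x p : path (edge X) x p ->
  edge_homotopic X (rev (x :: p) ++ p) [:: last x p].
Proof.
elim: p x => [|y p IH] x /=; first by move=> _; apply: EH_refl.
case/andP=> exy /IH; apply: EH_trans.
rewrite !rev_cons -!cats1 -!catA.
apply: (@EH_backtrack _ X (rev p) p y x); by rewrite edge_sym.
Qed.

(** The homotopy inserts the retraced path d^-1 d at the end of p and then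
    contracts the loop p d^-1. *)
Lemma homotopic_of_loop x p d : path (edge X) x d -> last x p = last x d ->
  null_homotopic X x (p ++ rev (belast x d)) ->
  edge_homotopic X (x :: p) (x :: d).
Proof.
move=> Hd pd /(homotopic_catr d) /=; apply: EH_trans.
have -> : x :: (p ++ rev (belast x d)) ++ d = belast x p ++ (rev (x :: d) ++ d).
  by rewrite [x :: d]lastI rev_rcons cat_cons -pd -catA -cat_rcons -lastI.
rewrite lastI -cats1 pd; apply: homotopic_catl.
exact/EH_sym/homotopic_retrace.
Qed.

Lemma rev_belast_path x d : path (edge X) x d ->
  path (edge X) (last x d) (rev (belast x d)).
Proof. by rewrite rev_path (eq_path (e' := edge X)) // => y z; rewrite edge_sym. Qed.

Lemma last_rev_belast x d : last (last x d) (rev (belast x d)) = x.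
Proof. by case: d => //= y d; rewrite rev_cons last_rcons. Qed.

(** Each vertex y of A is joined to the centre x by a path d_y of length at most
    r. For an edge y z, the loop d_y (y z) d_z^-1 has length at most 2r + 1, so it
    is null-homotopic; by induction d_y p ~ d_z for every path p in A from y to
    z. For a closed p this reads d_y p ~ d_y, and d_y can be cancelled. *)
Lemma ball_pi1_trivial A r x : vertices X x -> short_loops_trivial X r.*2.+2 ->
  (forall y, A y -> exists2 d, path (edge X) x d & last x d = y /\ (size d <= r)%N) ->
  pi1_trivial (induced X A) X.
Proof.
move=> Xx Hk HA.
have bigon d d' : path (edge X) x d -> path (edge X) x d' -> last x d = last x d' ->
    (size d + size d' < r.*2.+2)%N -> edge_homotopic X (x :: d) (x :: d').
  move=> Hd Hd' E le; apply: homotopic_of_loop => //; apply: Hk.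
    split; first split=> //.
      by rewrite cat_path Hd E rev_belast_path.
    by rewrite last_cat E last_rev_belast.
  by rewrite size_cat size_rev size_belast.
have extend p : forall y d d', path (edge (induced X A)) y p ->
    path (edge X) x d -> last x d = y -> (size d <= r)%N ->
    path (edge X) x d' -> last x d' = last y p -> (size d' <= r)%N ->
    edge_homotopic X (x :: d ++ p) (x :: d').
  elim: p => [|z p IH] y d d' /=.
    move=> _ Hd <- sd Hd' E sd'; rewrite cats0; apply: bigon => //.
    lia.
  rewrite edge_induced => /andP [/and3P [eyz _ /set_mem Az] Hp] Hd E sd Hd' E' sd'.
  have [dz Hdz [Ez sdz]] := HA _ Az.
  apply: EH_trans (IH z dz d' Hp Hdz Ez sdz Hd' E' sd').
  rewrite -cat_rcons -!cat_cons; apply: homotopic_catr; apply: bigon => //.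
  - by rewrite rcons_path Hd E.
  - by rewrite last_rcons Ez.
  - rewrite size_rcons; lia.
move=> y p [[/induced_vertex [_ Ay] Hp] Hl].
have [d Hd [E sd]] := HA _ Ay.
have R := homotopic_retrace Hd.
apply: EH_trans (_ : edge_homotopic X ((rev (x :: d) ++ d) ++ p) _).
  by rewrite -[y :: p]/([:: y] ++ p) -E; apply/EH_sym/homotopic_catr.
rewrite -E; apply: EH_trans R.
rewrite rev_cons cat_rcons -catA; apply: homotopic_catl.
exact: (extend p y d d Hp Hd E sd Hd (etrans E (esym Hl)) sd).
Qed.


(** * Separated unions *)

Lemma path_in_separated A B x p :
  (forall y z, A y -> B z -> ~~ edge X y z) -> A x ->
  path (edge (induced X (A `|` B))) x p -> path (edge (induced X A)) x p.
Proof.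
move=> sep; elim: p x => //= y p IH x Ax.
rewrite !edge_induced => /andP [/and3P [exy _ /set_mem ABy] Hp].
have Ay : A y by case: ABy => // By; rewrite (negPf (sep x y Ax By)) in exy.
by rewrite exy !mem_set //= IH.
Qed.

Lemma pi1_trivial_separatedU A B :
  (forall x y, A x -> B y -> ~~ edge X x y) ->
  pi1_trivial (induced X A) X -> pi1_trivial (induced X B) X ->
  pi1_trivial (induced X (A `|` B)) X.
Proof.
move=> sep HA HB x p [[/induced_vertex [Xx [Ax|Bx]] Hp] Hl].
  apply: HA; split=> //; split; first exact/induced_vertex.
  exact: path_in_separated Hp.
apply: HB; split=> //; split; first exact/induced_vertex.
apply: (@path_in_separated _ A) => //; last by rewrite setUC.
by move=> y z By Az; rewrite edge_sym sep.
Qed.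

(** * Connected components and inessential sets *)

Definition reachable v : set T :=
  [set w | exists2 p, edge_path X v p & last v p = w].

Lemma reachable_edge v x y : edge X x y -> reachable v x -> reachable v y.
Proof.
move=> exy [p [Xv Hp] Hl]; exists (rcons p y); last by rewrite last_rcons.
by split=> //; rewrite rcons_path Hp Hl.
Qed.

Lemma face3_edges x y z : uniq [:: x; y; z] -> faces X [fset x; y; z]%fset ->
  [/\ edge X x y, edge X y z & edge X x z].
Proof.
rewrite /= !inE negb_or andbT -andbA => /and3P [xy xz yz] F.
have sub a b : a \in [fset x; y; z]%fset -> b \in [fset x; y; z]%fset -> a != b ->
    edge X a b.
  move=> aF bF ab; rewrite /edge ab; apply/mem_set/(face_sub F).
    by apply/fsubsetP => c; rewrite in_fset2 => /orP [] /eqP->.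
  by rewrite -cardfs_eq0 cardfs2.
by split; apply: sub; rewrite // !inE eqxx ?orbT.
Qed.

(** The elementary moves act on arbitrary vertex sequences, so the intermediate
    stages of a homotopy need not visibly be paths in the component. Being an
    edge walk inside the component is however invariant under each move in both
    directions; carrying this equivalence through the induction is what makes
    the symmetric and transitive cases go through. *)
Lemma homotopic_component v s t : edge_homotopic X s t ->
  let walk u := sorted (edge X) u /\ (forall w, w \in u -> reachable v w) in
  (walk s <-> walk t) /\ (walk s -> edge_homotopic (component X v) s t).
Proof.
move=> H walk; elim: H => {s t}.
- by move=> p; split=> // _; apply: EH_refl.
- move=> p q _ [pq hpq]; split; first by apply: iff_sym.
  by move=> /pq /hpq; apply: EH_sym.
- move=> p q r _ [pq hpq] _ [qr hqr]; split; first exact: iff_trans pq qr.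
  by move=> wp; apply: EH_trans (hpq wp) _; apply/hqr/pq.
- move=> s t x y exy; split.
    rewrite /walk /= !sorted_cat_cons /= exy edge_sym exy /=.
    split=> -[-> H]; split=> // w; rewrite !(mem_cat, inE) => Hw.
      by apply: H; rewrite !(mem_cat, inE); case/or3P: Hw => ->; rewrite ?orbT.
    have Kx : reachable v x by apply: H; rewrite !(mem_cat, inE) eqxx orbT.
    have Ky := reachable_edge exy Kx.
    case/orP: Hw => [Hw|/or4P [/eqP->|/eqP->|/eqP->|Hw]] //;
      by apply: H; rewrite !(mem_cat, inE) Hw ?orbT.
  case=> _ H; apply: EH_backtrack.
  by rewrite edge_induced exy !mem_set //; apply: H; rewrite !(mem_cat, inE) eqxx ?orbT.
- move=> s t x y z u F; have [exy eyz exz] := face3_edges u F; split.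
    rewrite /walk /= !sorted_cat_cons /= exy eyz exz /=.
    split=> -[-> H]; split=> // w; rewrite !(mem_cat, inE) => Hw.
      by apply: H; rewrite !(mem_cat, inE); case/or4P: Hw => ->; rewrite ?orbT.
    have Kx : reachable v x by apply: H; rewrite !(mem_cat, inE) eqxx orbT.
    have Ky := reachable_edge exy Kx; have Kz := reachable_edge exz Kx.
    case/orP: Hw => [Hw|/or4P [/eqP->|/eqP->|/eqP->|Hw]] //;
      by apply: H; rewrite !(mem_cat, inE) Hw ?orbT.
  case=> _ H; apply: EH_triangle => //; split=> // w.
  by rewrite !inE -orbA => Hw; apply: H; rewrite !(mem_cat, inE);
    case/or3P: Hw => ->; rewrite ?orbT.
Qed.

Lemma reachable_path v x p : path (edge X) x p -> reachable v x ->
  forall w, w \in x :: p -> reachable v w.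
Proof.
elim: p x => [|y p IH] x /=; first by move=> _ Kx w; rewrite inE => /eqP->.
case/andP=> exy Hp Kx w; rewrite inE => /predU1P [->//|].
exact: IH Hp (reachable_edge exy Kx) w.
Qed.

Lemma last_vertex A x p : vertices (induced X A) x ->
  path (edge (induced X A)) x p -> vertices (induced X A) (last x p).
Proof.
elim: p x => //= y p IH x _ /andP [exy]; apply: IH; move: exy.
rewrite edge_induced => /and3P [/edge_vertices [_ Xy] _ /set_mem Ay].
exact/induced_vertex.
Qed.

End Complex.

Section Inessential.
Variables (T : choiceType) (X : complex T).
Implicit Types (A B : set T) (x y z : T) (p q d s t : seq T).

Lemma inessential_of_pi1_trivial A : A `<=` vertices X ->
  pi1_trivial (induced X A) X -> inessential X A.
Proof.
move=> AX HA; split=> // v /induced_vertex [Xv _] x p loop.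
have loopA := closed_edge_path_induced loop.
have [[/induced_vertex [_ [q [_ Hq] Hl]] _] _] := loop.
have [[_ Hp] _] := closed_edge_path_induced loopA.
have Kx : reachable X v x.
  by exists q; [split=> //; apply: path_induced Hq|].
have [_] := homotopic_component v (HA x p loopA); apply; split=> //.
exact: reachable_path Hp Kx.
Qed.

(** Without such a loop the whole vertex set would be a single inessential part;
    when there are no vertices the empty partition is used, since parts must be
    nonempty. *)
Lemma essential_loop n : (0 < n)%N -> combinatorially_essential n X ->
  exists x p, closed_edge_path X x p /\ ~ null_homotopic X x p.
Proof.
move=> n0 Hn; apply: contrapT => Hloop; apply: Hn.
have triv : pi1_trivial (induced X (vertices X)) X.
  move=> x p /closed_edge_path_induced loop; apply: contrapT => nnull.
  by apply: Hloop; exists x, p.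
have [V0|V0] := pselect (vertices X = set0).
  exists 0%N, (fun=> set0); split=> //; rewrite II0; split=> //.
  by rewrite /cover bigcup_set0 V0.
exists 1%N, (fun=> vertices X); split=> //; last first.
  by move=> i _; apply: inessential_of_pi1_trivial.
split; first by rewrite /cover bigcup_const //; exists 0%N.
- by move=> [|i] [|j].
- by move=> _ _; apply/set0P/eqP.
Qed.

(** The recursive form of the nonexistence of a partition of W into at most n
    inessential parts: removing one inessential part leaves an (n-1)-essential
    set. Loops are contracted in X and not in W, so that the sets met in the
    induction all refer to one fixed complex, and thus to one systole. *)
Fixpoint essential_in n (W : {fset T}) : Prop :=
  if n is n'.+1 then
    forall Z : {fset T}, (Z `<=` W)%fset ->
      pi1_trivial (induced X [set` (W `\` Z)%fset]) X -> essential_in n' Z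
  else W != fset0.

Lemma essential_in_or_partition n (W : {fset T}) :
  [set` W] `<=` vertices X ->
  essential_in n W \/
  exists m (P : nat -> set T), [/\ (m <= n)%N, partition `I_m P [set` W] &
    forall i, `I_m i -> inessential X (P i)].
Proof.
elim: n W => [|n IH] W WX /=.
  have [->|W0] := eqVneq W fset0; last by left.
  right; exists 0%N, (fun=> set0); split=> //; rewrite II0; split=> //.
  by rewrite /cover bigcup_set0 set_fset0.
have [ess|] := pselect (forall Z : {fset T}, (Z `<=` W)%fset ->
      pi1_trivial (induced X [set` (W `\` Z)%fset]) X -> essential_in n Z).
  by left.
move=> /existsNP [Z /not_implyP [ZW /not_implyP [triv ness]]]; right.
have ZX : [set` Z] `<=` vertices X by move=> z /= /(fsubsetP ZW) /WX.
case: (IH Z ZX) => // -[m [P [mn [PU Pd Pne] Pi]]].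
have [D0|D0] := eqVneq (W `\` Z)%fset fset0.
  have -> : W = Z.
    by apply/eqP; rewrite eqEfsubset ZW -fsetD_eq0 D0 eqxx.
  by exists m, P; split=> //; apply: leqW.
pose Q i := if i == m then [set` (W `\` Z)%fset] else P i.
have Qm : Q m = [set` (W `\` Z)%fset] by rewrite /Q eqxx.
have QP i : `I_m i -> Q i = P i by rewrite /Q /= => im; rewrite ltn_eqF.
have QZ i : `I_m i -> Q i `<=` [set` Z].
  by move=> im x; rewrite QP // -PU => Px; exists i.
have cases i : `I_m.+1 i -> `I_m i \/ i = m.
  by rewrite /= ltnS leq_eqVlt => /orP [/eqP|]; [right|left].
exists m.+1, Q; split=> //; first split.
- rewrite /cover; apply/seteqP; split=> [x [i /cases [im|->]]|x /= xW].
  + by move=> /(QZ _ im) /= /(fsubsetP ZW).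
  + by rewrite Qm /= inE => /andP [].
  + have [xZ|xZ] := boolP (x \in Z).
      have : [set` Z] x by [].
      rewrite -PU => -[i im Pix]; exists i; first exact: ltnW im.
      by rewrite QP.
    by exists m; rewrite /= ?ltnSn // Qm /= inE xZ.
- move=> i j /cases [im|->] /cases [jm|->] [x []] //.
  + by rewrite !QP // => Pi' Pj; apply: Pd => //; exists x.
  + by move=> /(QZ _ im) /= xZ; rewrite Qm /= inE xZ.
  + by rewrite Qm => + /(QZ _ jm) /= xZ; rewrite /= inE xZ.
- move=> i /cases [im|->]; first by rewrite QP //; apply: Pne.
  by rewrite Qm; case/fset0Pn: D0 => x xD; exists x.
- move=> i /cases [im|->]; first by rewrite QP //; apply: Pi.
  rewrite Qm; apply: inessential_of_pi1_trivial => // x /=.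
  by rewrite inE => /andP [_ /WX].
Qed.


(** * Balls and minimal cutting sets *)

Implicit Types (Z W : {fset T}).

Definition ball (W : {fset T}) x r : {fset T} :=
  [fset y in W | `[< exists d, [/\ path (edge (induced X [set` W])) x d,
                                   (size d <= r)%N & last x d = y] >]]%fset.

Lemma ballP W x r y : reflect
  (y \in W /\ exists d, [/\ path (edge (induced X [set` W])) x d,
                            (size d <= r)%N & last x d = y])
  (y \in ball W x r).
Proof.
by rewrite !inE /=; apply: (iffP andP) => -[yW];
  [move=> /asboolP|]; split=> //; apply/asboolP.
Qed.

Lemma ball_sub W x r : (ball W x r `<=` W)%fset.
Proof. by apply/fsubsetP => y /ballP []. Qed.

Lemma center_in_ball W x r : x \in W -> x \in ball W x r.
Proof. by move=> xW; apply/ballP; split=> //; exists [::]. Qed.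

Lemma ballS W x r : (ball W x r `<=` ball W x r.+1)%fset.
Proof.
apply/fsubsetP => y /ballP [yW [d [Hd sd E]]]; apply/ballP; split=> //.
by exists d; split=> //; apply: leqW.
Qed.

Lemma sub_ball (Z W : {fset T}) x r : (Z `<=` W)%fset ->
  (ball Z x r `<=` ball W x r)%fset.
Proof.
move=> /fsubsetP ZW; apply/fsubsetP => y /ballP [yZ [d [Hd sd E]]].
apply/ballP; split; first exact: ZW.
by exists d; split=> //; apply: sub_path_induced Hd.
Qed.

Lemma ball_edge W x r y z :
  y \in ball W x r -> z \in W -> edge X y z -> z \in ball W x r.+1.
Proof.
move=> /ballP [yW [d [Hd sd E]]] zW eyz; apply/ballP; split=> //.
exists (rcons d z); rewrite size_rcons last_rcons; split=> //.
by rewrite rcons_path Hd E edge_induced eyz !mem_set.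
Qed.

Lemma minimal_cut (W : {fset T}) : exists Z : {fset T},
  [/\ (Z `<=` W)%fset, pi1_trivial (induced X [set` (W `\` Z)%fset]) X &
    forall Z' : {fset T}, (Z' `<=` W)%fset ->
      pi1_trivial (induced X [set` (W `\` Z')%fset]) X -> (#|` Z| <= #|` Z'|)%N].
Proof.
pose P k := `[< exists Z : {fset T}, [/\ (Z `<=` W)%fset,
  pi1_trivial (induced X [set` (W `\` Z)%fset]) X & #|` Z| = k] >].
have exP : exists k, P k.
  exists #|` W|; apply/asboolP; exists W; rewrite fsetDv; split=> //.
  by move=> x p [[/induced_vertex []]]; rewrite /= inE.
case: (ex_minnP exP) => k /asboolP [Z [ZW triv <-]] min; exists Z; split=> //.
by move=> Z' ZW' triv'; apply: min; apply/asboolP; exists Z'.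
Qed.

(** * Shortest essential loops *)

Lemma shortest_essential_loop (L : T -> seq T -> Prop) :
  (exists x p, L x p /\ ~ null_homotopic X x p) ->
  exists x p, [/\ L x p, ~ null_homotopic X x p &
    forall y q, L y q -> (size q < size p)%N -> null_homotopic X y q].
Proof.
move=> [x0 [p0 [L0 nn0]]].
pose P k := `[< exists x p, [/\ L x p, ~ null_homotopic X x p & size p = k] >].
have exP : exists k, P k by exists (size p0); apply/asboolP; exists x0, p0.
case: (ex_minnP exP) => k /asboolP [x [p [Lp nn <-]]] min; exists x, p.
split=> // y q Lq sq; apply: contrapT => nq.
suff /min : P (size q) by rewrite leqNgt sq.
by apply/asboolP; exists y, q.
Qed.

Lemma essential_in1_loop W : essential_in 1 W ->
  exists x p, closed_edge_path (induced X [set` W]) x p /\ ~ null_homotopic X x p.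
Proof.
move=> H; apply: contrapT => nloop.
have : (fset0 : {fset T}) != fset0 by
  apply: H => //; rewrite ?fsub0set // fsetD0 => x p Hp;
  apply: contrapT => ?; apply: nloop; exists x, p.
by rewrite eqxx.
Qed.

Lemma shortest_loop W : essential_in 1 W -> exists x p,
  [/\ closed_edge_path (induced X [set` W]) x p, ~ null_homotopic X x p &
    forall y q, closed_edge_path (induced X [set` W]) y q ->
      (size q < size p)%N -> null_homotopic X y q].
Proof. by move=> /essential_in1_loop /shortest_essential_loop. Qed.

(** If d were shorter than both arcs p and q of the loop, then p d^-1 and d q
    would both be shorter than the loop, hence null-homotopic, and so would be
    their product p q. *)
Lemma shortest_loop_geodesic W x p q d :
  closed_edge_path (induced X [set` W]) x (p ++ q) ->
  ~ null_homotopic X x (p ++ q) ->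
  (forall y q', closed_edge_path (induced X [set` W]) y q' ->
     (size q' < size (p ++ q))%N -> null_homotopic X y q') ->
  path (edge (induced X [set` W])) x d -> last x d = last x p ->
  (size p <= size d)%N \/ (size q <= size d)%N.
Proof.
move=> [[Xx]]; rewrite cat_path last_cat size_cat => /andP [Hp Hq] Hl nn min Hd E.
have [le|dp] := leqP (size p) (size d); [by left | right].
rewrite leqNgt; apply/negP => dq; apply: nn.
apply: (@EH_trans _ _ _ (x :: d ++ q)).
  rewrite -!cat_cons; apply: homotopic_catr; apply: homotopic_of_loop => //.
    exact: path_induced Hd.
  apply: min; last by rewrite size_cat size_rev size_belast ltn_add2l.
  split; first split=> //.
    rewrite cat_path Hp -E rev_path.
    apply: sub_path Hd => y z /=; rewrite !edge_induced edge_sym.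
    by rewrite [X in _ && X]andbC.
  by rewrite last_cat -E last_rev_belast.
apply: min; last by rewrite size_cat ltn_add2r.
by split; [split=> //; rewrite cat_path Hd E | rewrite last_cat E].
Qed.

(** * Growth of balls in essential sets *)

Variable m : nat.
Hypothesis m_gt0 : (0 < m)%N.
Hypothesis short : short_loops_trivial X m.*2.

Lemma small_ball_pi1_trivial (W : {fset T}) x r :
  vertices X x -> (r < m)%N -> pi1_trivial (induced X [set` ball W x r]) X.
Proof.
move=> Xx rm; apply: (@ball_pi1_trivial _ _ _ r x) => //.
  by move=> y q loop sq; apply: short => //; lia.
move=> y /ballP [_ [d [Hd sd E]]]; exists d => //; exact: path_induced Hd.
Qed.

(** The set obtained from Z by trading its part inside the ball B' of radius
    r + 1 for the sphere B' minus B still cuts W: what is left is B together with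
    a part of W outside B' and Z, two inessential sets that no edge joins. *)
Lemma cut_sphere (W Z : {fset T}) x r :
  [set` W] `<=` vertices X -> x \in W -> (r < m)%N -> (Z `<=` W)%fset ->
  pi1_trivial (induced X [set` (W `\` Z)%fset]) X ->
  (forall Z' : {fset T}, (Z' `<=` W)%fset ->
      pi1_trivial (induced X [set` (W `\` Z')%fset]) X -> (#|` Z| <= #|` Z'|)%N) ->
  (#|` (Z `&` ball W x r.+1)%fset| <= #|` (ball W x r.+1 `\` ball W x r)%fset|)%N.
Proof.
move=> WX xW rm ZW triv min.
set B := ball W x r; set B' := ball W x r.+1.
pose Z' := ((Z `\` B') `|` (B' `\` B))%fset.
have ZW' : (Z' `<=` W)%fset.
  apply/fsubsetP => y; rewrite !inE => /orP [/andP [_ /(fsubsetP ZW)] //|].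
  by move=> /andP [_ /andP []].
have /(min _ ZW') : pi1_trivial (induced X [set` (W `\` Z')%fset]) X.
  apply: (@pi1_trivial_sub _ _ _ ([set` (W `\` Z `\` B')%fset] `|` [set` B])).
    move=> y /=; rewrite in_fsetD => /andP [+ yW].
    rewrite in_fsetU !in_fsetD yW andbT.
    have [yB _|yB H] := boolP (y \in B); [by right | left].
    by move: H; case: (y \in B'); case: (y \in Z).
  apply: pi1_trivial_separatedU.
  - move=> y z /=; rewrite !in_fsetD => /and3P [yB' _ yW] zB.
    by apply: contra yB'; rewrite edge_sym => /(ball_edge zB yW).
  - by apply: pi1_trivial_sub triv => y /=; rewrite in_fsetD => /andP [].
  - exact/small_ball_pi1_trivial/rm/WX.
move=> leZ; rewrite -(leq_add2r #|` (Z `\` B')%fset|) cardfsID.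
by apply: leq_trans leZ _; rewrite addnC -cardfsUI leq_addr.
Qed.

Lemma ball_growth (W : {fset T}) x (f g : nat -> nat) :
  x \in W -> f 0%N = 1%N -> (forall r, f r.+1 = f r + g r.+1)%N ->
  (forall r, (r.+1 < m)%N ->
     (g r.+1 <= #|` (ball W x r.+1 `\` ball W x r)%fset|)%N) ->
  forall r, (r < m)%N -> (f r <= #|` ball W x r|)%N.
Proof.
move=> xW f0 fS H; elim=> [|r IH] rm.
  rewrite f0 cardfs_gt0; apply/fset0Pn; exists x; exact: center_in_ball.
have := IH (ltnW rm); have := H r rm; rewrite fS cardfsDS ?ballS //.
have := fsubset_leq_card (ballS W x r).
lia.
Qed.

(** The two points of the sphere of radius i are those at arc distance i from x
    on either side of x along a shortest essential loop. They are at distance i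
    in W since a shorter path would be a shortcut of the loop, and they are
    distinct since otherwise the arc b between them would be a shorter loop; both
    b and the loop a c left after contracting b would then be null-homotopic. *)
Lemma essential1_spheres W : essential_in 1 W ->
  exists2 x, x \in W & forall r, (r.+1 < m)%N ->
     (2 <= #|` (ball W x r.+1 `\` ball W x r)%fset|)%N.
Proof.
move=> /shortest_loop [x [p [loop nn min]]].
have [[/induced_vertex [Xx xW] Hp] Hl] := loop.
have pm : (m.*2 <= size p)%N.
  rewrite leqNgt; apply/negP => sp; apply: nn; apply: short => //.
  exact: closed_edge_path_induced loop.
exists x => // r rm; set i := r.+1.
have pE : p = take i p ++ (take (size p - i.*2) (drop i p) ++ drop (size p - i) p).
  rewrite -[LHS](cat_take_drop i) -[X in _ ++ X = _](cat_take_drop (size p - i.*2)).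
  by rewrite drop_drop; congr (_ ++ (_ ++ drop _ _)); lia.
move: pE; set a := take i p; set b := take _ _; set c := drop _ _ => pE.
have sa : size a = i by rewrite size_take; case: ltnP => //; lia.
have sc : size c = i by rewrite size_drop; lia.
have spE : size p = (i + (size b + i))%N by rewrite pE !size_cat sa sc.
have sb : (0 < size b)%N by lia.
move: Hp Hl; rewrite pE !cat_path !last_cat => /and3P [Ha Hb Hc] Hl.
pose y := last x a; pose z := last y b.
have Vx : vertices (induced X [set` W]) x by case: loop => -[].
have Vy : vertices (induced X [set` W]) y := last_vertex Vx Ha.
have [_ yW] := (induced_vertex _ _ _).1 Vy.
have [_ zW] := (induced_vertex _ _ _).1 (last_vertex Vy Hb).
have Hc' : path (edge (induced X [set` W])) x (rev (belast z c)).
  rewrite -Hl rev_path; apply: sub_path Hc => u v; rewrite !edge_induced edge_sym.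
  by rewrite [X in _ && X]andbC.
have Ec' : last x (rev (belast z c)) = z by rewrite -Hl last_rev_belast.
have yz : y != z.
  apply/eqP => yz; apply: nn; rewrite pE.
  apply: (@EH_trans _ _ _ (x :: a ++ c)).
    rewrite -!cat_cons lastI -!cats1 -!catA; apply: homotopic_catl.
    rewrite (catA [:: _] b); apply: homotopic_catr; rewrite -/y.
    by apply: min; last lia; split.
  apply: min; last by rewrite size_cat; lia.
  split; last by rewrite last_cat -/y yz.
  by split=> //; rewrite cat_path Ha -/y yz.
suff : ([fset y; z] `<=` ball W x i `\` ball W x r)%fset.
  by move=> /fsubset_leq_card; rewrite cardfs2 yz.
apply/fsubsetP => w; rewrite in_fset2 in_fsetD => /orP [] /eqP->.
  apply/andP; split; last first.
    by apply/ballP; split=> //; exists a; rewrite sa.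
  apply/negP => /ballP [_ [d [Hd sd E]]].
  move: loop nn min; rewrite pE => loop nn min.
  by have [] := shortest_loop_geodesic loop nn min Hd E; rewrite ?size_cat; lia.
apply/andP; split; last first.
  by apply/ballP; split=> //; exists (rev (belast z c)); rewrite size_rev size_belast sc.
apply/negP => /ballP [_ [d [Hd sd E]]].
move: loop nn min; rewrite pE catA => loop nn min.
have := @shortest_loop_geodesic _ _ _ _ _ loop nn min Hd.
by rewrite last_cat => /(_ E) []; rewrite ?size_cat; lia.
Qed.

(** The closed form of the recursion for ball sizes, with the index shifted by
    one: it bounds balls of radius r in (n+1)-essential sets. *)
Definition ball_bound n r := ('C(n + r, n) + 2 * 'C(n + r, n.+1))%N.

Lemma ball_bound0 n : ball_bound n 0 = 1%N.
Proof. by rewrite /ball_bound addn0 binn bin_small. Qed.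

Lemma ball_boundS n r :
  ball_bound n.+1 r.+1 = (ball_bound n.+1 r + ball_bound n r.+1)%N.
Proof. by rewrite /ball_bound !addnS !addSn !binS; lia. Qed.

(** The bound on |W| is obtained from the ball of radius m - 1: its complement
    cuts W, so it is nonempty if W is 1-essential, and in general it has at least
    as many elements as a minimal cutting set, which contributes
    ball_bound n m - 1. *)
Lemma essential_in_bound n (W : {fset T}) :
  [set` W] `<=` vertices X -> essential_in n.+1 W ->
  (exists2 x, x \in W & forall r, (r < m)%N -> (ball_bound n r <= #|` ball W x r|)%N)
  /\ (ball_bound n m - 1 <= #|` W|)%N.
Proof.
elim: n W => [|n IH] W WX ess.
  have [x xW sph] := essential1_spheres ess.
  have B : forall r, (r < m)%N -> (ball_bound 0 r <= #|` ball W x r|)%N.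
    apply: (@ball_growth _ _ _ (fun=> 2)) => //.
    by move=> r; rewrite /ball_bound !add0n !bin0 !bin1; lia.
  split; first by exists x.
  have m1 : (m.-1 < m)%N by rewrite prednK.
  have : (0 < #|` (W `\` ball W x m.-1)%fset|)%N.
    rewrite cardfs_gt0; apply: (ess _ (fsubsetDl _ _)).
    rewrite fsetDK ?ball_sub //; exact: small_ball_pi1_trivial (WX _ xW) m1.
  rewrite cardfsDS ?ball_sub //; have := B _ m1.
  rewrite /ball_bound !add0n !bin0 !bin1; lia.
have [Z [ZW triv min]] := minimal_cut W.
have ZX : [set` Z] `<=` vertices X by move=> z /= /(fsubsetP ZW) /WX.
have [[x xZ sph] tot] := IH Z ZX (ess Z ZW triv).
have xW := fsubsetP ZW _ xZ.
have B : forall r, (r < m)%N -> (ball_bound n.+1 r <= #|` ball W x r|)%N.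
  apply: (@ball_growth _ _ _ (ball_bound n)) => //;
    [exact: ball_bound0 | exact: ball_boundS |].
  move=> r rm; apply: leq_trans (sph _ rm) _.
  apply: leq_trans (cut_sphere WX xW (ltnW rm) ZW triv min).
  apply: fsubset_leq_card; rewrite fsubsetI ball_sub; exact: sub_ball.
split; first by exists x.
have m1 : (m.-1 < m)%N by rewrite prednK.
have : (#|` Z| <= #|` (W `\` ball W x m.-1)%fset|)%N.
  apply: min (fsubsetDl _ _) _.
  rewrite fsetDK ?ball_sub //; exact: small_ball_pi1_trivial (WX _ xW) m1.
rewrite cardfsDS ?ball_sub //; have := B _ m1.
have := ball_boundS n m.-1; rewrite prednK // => ->.
have := fsubset_leq_card (ball_sub W x m.-1).
lia.
Qed.

End Inessential.

(** * The systole and the final estimate *)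

Lemma systole_fin (T : choiceType) (X : complex T) n :
  (0 < n)%N -> combinatorially_essential n X ->
  exists s, [/\ systole X = EFin s, short_loops_trivial X s & (1 < s)%N].
Proof.
move=> n0 /(essential_loop n0) /shortest_essential_loop [x [p [loop nn short]]].
exists (size p).
have max j : short_loops_trivial X j -> (j <= size p)%N.
  by move=> Hj; rewrite leqNgt; apply/negP => sj; apply: nn; apply: Hj.
(* Loops of length 0 and 1: the latter do not exist, as edges join distinct
   vertices. *)
split=> //; last first.
  apply: max => y q [[_ Hq] Hl]; case: q Hq Hl => [|z [|? ?]] //=.
    by move=> _ _ _; apply: EH_refl.
  by move=> /andP [/andP [yz _] _] zy; rewrite zy eqxx in yz.
apply: xget_unique; first by exists (size p).
by move=> _ [k [Hk maxk] <-]; congr (EFin _); apply/eqP; rewrite eqn_leq max // maxk.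
Qed.

Lemma exp_leq_ffact n r : (r.+1 ^ n <= (n + r) ^_ n)%N.
Proof.
elim: n => [|n IH]; first by rewrite expn0 ffactn0.
rewrite expnS addSn ffactSS leq_mul //; lia.
Qed.

Theorem theorem1p4 (T : choiceType) (n : nat) (X : complex T) :
  (1 <= n)%N ->
  combinatorially_essential n X ->
  exists s : nat,
    systole X = EFin s /\
    (let N := ('C(n + s./2 - 1, n - 1) + 2 * 'C(n + s./2 - 1, n) - 1)%N in
     [/\ (`I_N #<= vertices X)%card,
         ('C(n + s./2, n) <= N)%N &
         ((n`!%:R^-1 * (uphalf s)%:R ^+ n : rat) <= 'C(n + s./2, n)%:R)%R]).
Proof.
move=> n0 ess; have [s [sysE short s1]] := systole_fin n0 ess.
exists s; split=> //; set m := s./2; set N := (_ - 1)%N.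
have m_gt0 : (0 < m)%N by rewrite /m; lia.
have short2 : short_loops_trivial X m.*2.
  by move=> x p loop sp; apply: short => //; rewrite /m in sp; lia.
case: n => // n in n0 ess N *.
have NE : N = (ball_bound n m - 1)%N.
  by rewrite /N /ball_bound addSn !subn1.
split.
- have [fin|inf] := pselect (finite_set (vertices X)); last first.
    by apply: card_le_trans ((infiniteP _).1 inf); apply: subset_card_le.
  have [W WE] := finite_fsetP.1 fin.
  have WX : [set` W] `<=` vertices X by rewrite WE.
  have [essW|part] := essential_in_or_partition n.+1 WX; last first.
    by rewrite -WE in part; case: ess.
  have [_ le] := essential_in_bound m_gt0 short2 WX essW.
  by rewrite WE (card_le_eqr (introT card_eq_fsetP erefl)) card_le_II NE.
- have : (0 < 'C(n + m, n.+1))%N by rewrite bin_gt0; lia.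
  rewrite NE /ball_bound addSn binS; lia.
- have f0 : (0 < n.+1`!%:R :> rat)%R by rewrite Num.Theory.ltr0n fact_gt0.
  rewrite Num.Theory.ler_pdivrMl // -GRing.natrX -GRing.natrM.
  rewrite Num.Theory.ler_nat mulnC bin_ffact.
  apply: leq_trans (exp_leq_ffact n.+1 m); rewrite leq_exp2r //.
  rewrite /m; lia.
Qed.
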